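(* Let $(X_1,\mu_1),\ldots,(X_n,\mu_n)$ be $\sigma$-finite measure spaces with product $(X,\mu)$. Let $p_1,\ldots,p_n\in(0,\infty]$ with $p_1\ge\cdots\ge p_n$, and let $$P=\left(\begin{array}{ccc}p_1&\cdots&p_n\\ x_1&\cdots&x_n\end{array}\right).$$ Let the orbit $\{P_\sigma:\sigma\in S_n\}$, modulo the identification of double $n$-tuples which differ only in the order of the variables within blocks of consecutive repeated exponents, be enumerated by $P_1,\ldots,P_m$. Then for any functions $f_1,\ldots,f_m\in L^+(X)$, $$\left\|\prod_{i=1}^m f_i^{1/m}\right\|_{L^{\overline p}(X)}\le\prod_{i=1}^m\left\|f_i\right\|_{P_i}^{1/m},$$ where $\overline p=\left(\frac1n\sum_{j=1}^n p_j^{-1}\right)^{-1}$ is the harmonic mean of the exponents.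
   Context: $L^+(X)$ denotes the cone of nonnegative measurable functions on $X=X_1\times\cdots\times X_n$; $x_j$ denotes the variable ranging over $X_j$. Mixed norms: let $r_1,\ldots,r_n\in(0,\infty]$ and let $y_1,\ldots,y_n$ be the variables $x_1,\ldots,x_n$ listed in some order, $y_j=x_{\pi(j)}$ with $\pi\in S_n$. For the double $n$-tuple $R=\left(\begin{array}{ccc}r_1&\cdots&r_n\\ y_1&\cdots&y_n\end{array}\right)$, the mixed norm $\|f\|_R$ of a measurable $f$ on $X$ is obtained by taking first the $L^{r_1}$ (quasi-)norm of $|f|$ in the variable $y_1$ (over $X_{\pi(1)}$), then the $L^{r_2}$ (quasi-)norm of the result in the variable $y_2$, and so on up to the $L^{r_n}$ (quasi-)norm in $y_n$; when all exponents are finite, $$\|f\|_R=\left(\int_{X_{\pi(n)}}\cdots\left(\int_{X_{\pi(1)}}|f|^{r_1}\,d\mu_{\pi(1)}\right)^{r_2/r_1}\cdots\,d\mu_{\pi(n)}\right)^{1/r_n},$$ and if some $r_j=\infty$ the corresponding step is the essential supremum. Exponents smaller than $1$ are allowed, and the value may be $+\infty$. Similarly $\|\cdot\|_{L^p(X)}$ for $p\in(0,\infty]$ is the usual (quasi-)norm. For $\sigma\in S_n$, $P_\sigma=\left(\begin{array}{ccc}p_1&\cdots&p_n\\ x_{\sigma(1)}&\cdots&x_{\sigma(n)}\end{array}\right)$ (the exponents keep their order, the variables are permuted). Identified double $n$-tuples define the same mixed norm, by Tonelli's theorem. If the distinct values among $p_1,\ldots,p_n$ occur with multiplicities $n_1,\ldots,n_r$,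 then the number of elements of the orbit modulo the identification is $m=\frac{n!}{n_1!\cdots n_r!}$. In the harmonic mean, $1/\infty=0$ and $1/0=\infty$. *)

(* Defs.v *)
From HB Require Import structures.
From mathcomp Require Import all_boot all_order all_fingroup all_algebra.
From mathcomp Require Import all_classical all_reals all_analysis.
From mathcomp Require Import measurable_realfun ess_sup_inf.

Set Implicit Arguments.
Unset Strict Implicit.
Unset Printing Implicit Defensive.

Import Order.TTheory GRing.Theory Num.Theory.

Local Open Scope classical_set_scope.
Local Open Scope ring_scope.
Local Open Scope ereal_scope.

Section finite_product_space.
Context {n : nat} {d : 'I_n -> measure_display}.

Definition pispace (T : forall i, measurableType (d i)) : Type := forall i, T i.

Definition pispace_display (e : 'I_n -> measure_display) : measure_display.
Proof. by case: n e => [|k] e; [exact: default_measure_display|exact: (e ord0)].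
Qed.

Context (T : forall i, measurableType (d i)).

Definition pispace_measurable : set (set (pispace T)) :=
  <<s \bigcup_(i : 'I_n)
        preimage_set_system setT (fun x : pispace T => x i) measurable >>.

Let pispace_measurable0 : pispace_measurable set0.
Proof. exact: sigma_algebra0. Qed.

Let pispace_measurableC A : pispace_measurable A -> pispace_measurable (~` A).
Proof. exact: sigma_algebraC. Qed.

Let pispace_measurable_bigcup (F : (set (pispace T))^nat) :
  (forall k, pispace_measurable (F k)) -> pispace_measurable (\bigcup_k F k).
Proof. exact: sigma_algebra_bigcup. Qed.

HB.instance Definition _ := Pointed.copy (pispace T) (forall i, T i).
HB.instance Definition _ := @isMeasurable.Build (pispace_display d) (pispace T)
  pispace_measurable pispace_measurable0 pispace_measurableC pispace_measurable_bigcup.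

Lemma measurable_coord i : measurable_fun [set: pispace T] (fun x => x i).
Proof.
move=> _ A mA; apply: sub_sigma_algebra; exists i => //.
by exists A.
Qed.

Lemma measurable_to_pispace d' (S : measurableType d') (h : S -> pispace T) :
  (forall i, measurable_fun [set: S] (fun s => h s i)) ->
  measurable_fun [set: S] h.
Proof.
move=> mh _ A mA; rewrite setTI.
suff: <<s \bigcup_(i : 'I_n) preimage_set_system setT
   (fun x : pispace T => x i) measurable >> `<=` [set B | measurable (h @^-1` B)].
  exact.
apply: smallest_sub; last first.
  move=> B [i _ [C mC <-]] /=; rewrite setTI.
  by have := mh i measurableT C mC; rewrite setTI.
split => /=.
- by rewrite preimage_set0.
- by move=> B; rewrite setTD -preimage_setC => /measurableC.
- by move=> F mF; rewrite preimage_bigcup; exact: bigcup_measurable.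
Qed.

Definition subst_coord (x : pispace T) k (t : T k) : pispace T := dfwith x k t.

Lemma measurable_subst_coord i :
  measurable_fun setT (fun z : pispace T * T i => subst_coord z.1 z.2).
Proof.
apply: measurable_to_pispace => j; rewrite /subst_coord.
have [<-|ij] := eqVneq i j.
  by under eq_fun do rewrite dfwithin; exact: measurable_snd.
under eq_fun do rewrite dfwithout//.
exact: (measurableT_comp (@measurable_coord j) measurable_fst).
Qed.

End finite_product_space.

Section product_measure.
Context {R : realType} {n : nat} {d : 'I_n -> measure_display}.
Context {T : forall i, measurableType (d i)}.
Context (mu : forall i, {sigma_finite_measure set (T i) -> \bar R}).
Implicit Types f : pispace T -> \bar R.

Definition partial_integral k f : pispace T -> \bar R :=
  fun x => \int[mu k]_t f (subst_coord x t).

(* After the last variable has been integrated out the function is constant,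
   so the point at which it is evaluated is irrelevant. *)
Definition pispace_measure (A : set (pispace T)) : \bar R :=
  foldl (fun g k => partial_integral k g) (EFin \o \1_A) (enum 'I_n) point.

Let measurable_section k f x : measurable_fun setT f ->
  measurable_fun setT (fun t : T k => f (subst_coord x t)).
Proof.
move=> mf; apply: measurableT_comp => //.
apply: measurable_to_pispace => j; rewrite /subst_coord.
have [<-|ij] := eqVneq k j.
  by under eq_fun do rewrite dfwithin; exact: measurable_id.
by under eq_fun do rewrite dfwithout//; exact: measurable_cst.
Qed.

Let partial_integral_ge0 k f : (forall x, 0 <= f x) ->
  forall x, 0 <= partial_integral k f x.
Proof. by move=> f0 x; exact: integral_ge0. Qed.

Let partial_integral_meas k f : (forall x, 0 <= f x) ->
  measurable_fun setT f -> measurable_fun setT (partial_integral k f).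
Proof.
move=> f0 mf.
have mg : measurable_fun setT (fun z : pispace T * T k => f (subst_coord z.1 z.2)).
  exact: (measurableT_comp mf (@measurable_subst_coord _ _ T k)).
exact: (@measurable_fun_fubini_tonelli_F _ _ (pispace T) (T k) R (mu k) _ mg
  (fun z => f0 _)).
Qed.

Let iter_series (s : seq 'I_n) (F : (pispace T -> \bar R)^nat) :
  (forall k x, 0 <= F k x) -> (forall k, measurable_fun setT (F k)) ->
  foldl (fun g k => partial_integral k g) (fun x => \sum_(k <oo) F k x) s =
  (fun x => \sum_(k <oo) foldl (fun g k => partial_integral k g) (F k) s x).
Proof.
elim: s F => [//|j s IH] F F0 mF /=.
rewrite -(IH (fun k => partial_integral j (F k))); last 2 first.
- by move=> k x; exact: partial_integral_ge0.
- by move=> k; exact: partial_integral_meas.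
congr foldl; apply/funext => x; rewrite /partial_integral integral_nneseries//.
move=> k; exact: (@measurable_section j (F k) x (mF k)).
Qed.

Let iter_ge0 (s : seq 'I_n) f : (forall x, 0 <= f x) ->
  forall x, 0 <= foldl (fun g k => partial_integral k g) f s x.
Proof.
elim: s f => [//|j s IH] f f0 /= x.
by apply: IH => y; exact: partial_integral_ge0.
Qed.

Let iter0 (s : seq 'I_n) :
  foldl (fun g k => partial_integral k g) (cst 0) s = cst 0.
Proof.
elim: s => [//|j s IH] /=; rewrite -[RHS]IH; congr foldl.
by apply/funext => x; rewrite /partial_integral/= integral0.
Qed.

Let pispace_measure0 : pispace_measure set0 = 0.
Proof.
rewrite /pispace_measure (_ : _ \o _ = cst 0) ?iter0//.
by apply/funext => x /=; rewrite indic0.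
Qed.

Let pispace_measure_ge0 A : 0 <= pispace_measure A.
Proof. by apply: iter_ge0 => x; rewrite lee_fin. Qed.

Let pispace_measure_sigma_additive : semi_sigma_additive pispace_measure.
Proof.
move=> F mF tF mUF.
rewrite [X in _ --> X](_ : _ = \sum_(k <oo) pispace_measure (F k)).
  by apply: is_cvg_nneseries => *; exact: pispace_measure_ge0.
rewrite /pispace_measure.
rewrite (_ : _ \o _ = fun x => \sum_(k <oo) (EFin \o \1_(F k)) x).
  rewrite iter_series//.
  - by move=> k x; rewrite lee_fin.
  - by move=> k; apply/measurable_EFinP; exact: measurable_indic.
by apply/funext => x /=; rewrite indic_bigcup.
Qed.

HB.instance Definition _ := isMeasure.Build _ _ _ pispace_measure
  pispace_measure0 pispace_measure_ge0 pispace_measure_sigma_additive.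


Lemma pispace_measure_box (A : forall i, set (T i)) :
  (forall i, measurable (A i)) ->
  pispace_measure [set x | forall i, A i (x i)] = \prod_(i < n) mu i (A i).
Proof.
move=> mA.
pose F (s : seq 'I_n) (x : pispace T) : \bar R :=
  \prod_(i < n) (if i \in s then mu i (A i) else (\1_(A i) (x i))%:E).
have F_ge0 (s : seq 'I_n) x k :
    0 <= \prod_(i < n | i != k)
           (if i \in s then mu i (A i) else (\1_(A i) (x i))%:E).
  by apply: prode_ge0 => i _; case: ifP => _ //; rewrite lee_fin.
have step k s : k \notin s -> partial_integral k (F s) = F (k :: s).
  move=> ks; apply/funext => x; rewrite /partial_integral.
  under eq_integral => t _.
    rewrite /F (bigD1 k)//= (negbTE ks) /subst_coord dfwithin.
    under eq_bigr => i ik do rewrite dfwithout 1?eq_sym//.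
    over.
  rewrite ge0_integralZr//=; last first.
    by apply/measurable_EFinP; exact: measurable_indic.
  rewrite integral_indic// setIT /F [RHS](bigD1 k)//= inE eqxx; congr (_ * _).
  by apply: eq_bigr => i ik; rewrite inE (negbTE ik).
have iter (s s' : seq 'I_n) : uniq (rev s ++ s') ->
    foldl (fun g k => partial_integral k g) (F s') s = F (rev s ++ s').
  elim: s s' => [//|k s IH] s' /=; rewrite rev_cons cat_rcons => u.
  rewrite step ?IH//.
  by move: u; rewrite cat_uniq => /and3P[_ _ /=/andP[]].
rewrite /pispace_measure (_ : _ \o _ = F [::]); last first.
  apply/funext => x; rewrite /F /=.
  rewrite prodEFin; congr EFin; rewrite indicE.
  have [|/negP] := boolP (x \in _).
    rewrite inE => Ax; rewrite big1// => i _.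
    by rewrite indicE mem_set.
  rewrite inE => /existsNP[i nAi].
  by rewrite (bigD1 i)//= indicE memNset// mul0r.
rewrite iter ?cats0 ?rev_uniq ?enum_uniq//.
rewrite /F; apply: eq_bigr => i _.
by rewrite mem_rev mem_enum inE.
Qed.

End product_measure.

(* Position [j] carries the exponent [dexp j] and the variable [x_(dvar j)]. *)
Record dtuple (R : realType) (n : nat) := DTuple {
  dexp : 'I_n -> \bar R;
  dvar : {perm 'I_n} }.

Section mixed_norm.
Context {R : realType} {n : nat} {d : 'I_n -> measure_display}.
Context {T : forall i, measurableType (d i)}.
Context (mu : forall i, {sigma_finite_measure set (T i) -> \bar R}).

Definition partial_Lnorm k (r : \bar R) (f : pispace T -> \bar R) :
    pispace T -> \bar R :=
  fun x => 'N[mu k]_r[(fun t : T k => f (subst_coord x t))].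

(* Same remark as for [pispace_measure] about the final evaluation. *)
Definition mixed_norm (P : dtuple R n) (f : pispace T -> \bar R) : \bar R :=
  foldl (fun g j => partial_Lnorm (dvar P j) (dexp P j) g) f (enum 'I_n) point.

End mixed_norm.

Section orbit.
Context {R : realType} {n : nat}.
Implicit Types (r p : 'I_n -> \bar R) (P Q : dtuple R n).

(* [j] and [k] lie in one block of consecutive equal exponents. *)
Definition same_block r (j k : 'I_n) : Prop :=
  forall l : 'I_n, (minn j k <= l <= maxn j k)%N -> r l = r j.

Definition identified P Q : Prop :=
  dexp P =1 dexp Q /\
  exists rho : {perm 'I_n}, forall j,
    same_block (dexp P) j (rho j) /\ dvar Q j = dvar P (rho j).

(* [Ps] lists one representative of each class of the orbit [{P_s : s in S_n}]
   modulo identification. *)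
Definition enumerates_orbit p m (Ps : 'I_m -> dtuple R n) : Prop :=
  (forall i, exists s : {perm 'I_n}, Ps i = DTuple p s) /\
  (forall s : {perm 'I_n}, exists! i, identified (DTuple p s) (Ps i)).

(* The inverse of [\bar R] satisfies [+oo^-1 = 0] and [0^-1 = +oo]. *)
Definition exponent_hmean p : \bar R :=
  ((n%:R^-1)%:E * \sum_(j < n) (p j)^-1)^-1.

End orbit.

(* Main.v *)
Require Import Defs.
From HB Require Import structures.
From mathcomp Require Import all_boot all_order all_fingroup all_algebra.
From mathcomp Require Import all_classical all_reals all_analysis.
From mathcomp Require Import measurable_realfun ess_sup_inf.

(* In each P_i the largest exponents are innermost, so by Minkowski's integral
   inequality sorting its variables into the order x_1, ..., x_n, each variable
   keeping its exponent, can only decrease the norm. In this common order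
   Hoelder's inequality applies one variable at a time. The reciprocal exponent
   it produces in x_k is the average over i of the reciprocal exponents of x_k;
   transpositions of the variables permute the classes of the orbit, so this
   average does not depend on k and is that of the 1/p_j. A mixed norm with all
   exponents equal is an L^p norm by Tonelli's theorem. *)

Set Implicit Arguments.
Unset Strict Implicit.
Unset Printing Implicit Defensive.

Import Order.TTheory GRing.Theory Num.Theory.

Local Open Scope classical_set_scope.
Local Open Scope ring_scope.
Local Open Scope ereal_scope.

(** * Powers of extended reals and Young's inequality *)

Section ereal_power.
Context {R : realType}.
Implicit Types (x y u v : \bar R) (a b : R).

(** Exponents below 1 are harmless: Hoelder's inequality for products holds for all positive
    exponents, and Minkowski's inequality for exponents $1/t_1\ge 1/t_2$ reduces to the ratio
    $t_2/t_1\ge 1$. The exponent $+\infty$ is the obstacle, since an essential supremum is not an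
    integral. There the role of Tonelli's theorem is taken by null sets: if all sections of a
    measurable set in one direction are null, then almost all of its sections in the other direction
    are null. The common order $x_1,\ldots,x_n$ is also the order of integration that defines the
    product measure, so the two can be compared directly on simple functions. *)

Lemma ge0_le_poweR a x y : (0 <= a)%R -> 0 <= x -> x <= y -> x `^ a <= y `^ a.
Proof.
move=> a0 x0 xy; apply: gt0_ler_poweR => //.
- by rewrite in_itv/= x0 leey.
- by rewrite in_itv/= (le_trans x0 xy) leey.
Qed.

Lemma poweRK a x : (a != 0)%R -> 0 <= x -> (x `^ a) `^ a^-1 = x.
Proof. by move=> a0 x0; rewrite -poweRrM mulfV// poweRe1. Qed.

Lemma poweRVK a x : (a != 0)%R -> 0 <= x -> (x `^ a^-1) `^ a = x.
Proof. by move=> a0 x0; rewrite -poweRrM mulVf// poweRe1. Qed.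

Lemma young_poweR a b u v : (0 < a)%R -> (0 < b)%R -> (a + b = 1)%R ->
  0 <= u -> 0 <= v -> u `^ a * v `^ b <= a%:E * u + b%:E * v.
Proof.
move=> a0 b0 ab; case: u => [u| |]//; case: v => [v| |]//; last 3 first.
- by move=> u0 _; rewrite gt0_muley// addey ?leey.
- by move=> _ v0; rewrite gt0_muley// addye ?leey.
- by move=> _ _; rewrite !gt0_muley// addye ?leey.
move=> u0 v0; rewrite lee_fin in u0; rewrite lee_fin in v0.
rewrite !poweR_EFin -!EFinM -EFinD lee_fin.
(* Young's inequality for $u^a$ and $v^b$ with the conjugate exponents $1/a$ and $1/b$. *)
have := @conjugate_powR R (u `^ a)%R (v `^ b)%R a^-1%R b^-1%R (powR_ge0 _ _)
  (powR_ge0 _ _).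
rewrite !invr_gt0 !invrK => /(_ a0 b0 ab) /le_trans; apply.
rewrite -!powRrM !mulfV ?gt_eqF// !powRr1//.
by rewrite (mulrC u) (mulrC v).
Qed.

End ereal_power.

(** * Hoelder's inequality for integrals *)

Section hoelder_integral.
Context {R : realType} d (T : measurableType d) (mu : {measure set T -> \bar R}).
Implicit Types (f g u v : T -> \bar R).

Lemma measurable_fun_poweR f (a : R) : measurable_fun setT f ->
  measurable_fun setT (fun x => f x `^ a).
Proof. by move=> mf; apply: (measurableT_comp (measurable_poweR a)). Qed.

Lemma ge0_integral_eq0_ae f : measurable_fun setT f -> (forall x, 0 <= f x) ->
  \int[mu]_x f x = 0 -> \forall x \ae mu, f x = 0.
Proof.
move=> mf f0 if0.
have : \int[mu]_x `|f x| = 0.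
  by under eq_integral do rewrite gee0_abs//.
by move/(ae_eq_integral_abs mu measurableT mf); apply: filterS => x /(_ I).
Qed.

Lemma ae_eq0_integral f : (\forall x \ae mu, f x = 0) ->
  measurable_fun setT f -> \int[mu]_x f x = 0.
Proof.
move=> f0 mf; rewrite (ae_eq_integral (cst 0)) ?integral0//.
by apply: filterS f0 => x ->.
Qed.

(** Once [u] and [v] are divided by their integrals, Young's inequality integrates to $a+b=1$. If
    one integral is 0, the integrand on the left vanishes almost everywhere; if one is infinite and
    the other positive, the right-hand side is infinite. *)
Lemma hoelder_integral (a b : R) u v : (0 < a)%R -> (0 < b)%R -> (a + b = 1)%R ->
  measurable_fun setT u -> measurable_fun setT v ->
  (forall x, 0 <= u x) -> (forall x, 0 <= v x) ->
  \int[mu]_x (u x `^ a * v x `^ b) <=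
  (\int[mu]_x u x) `^ a * (\int[mu]_x v x) `^ b.
Proof.
move=> a0 b0 ab mu_ mv u0 v0.
have an0 : (a != 0)%R by rewrite gt_eqF.
have bn0 : (b != 0)%R by rewrite gt_eqF.
have muv : measurable_fun setT (fun x => u x `^ a * v x `^ b).
  by apply: emeasurable_funM; exact: measurable_fun_poweR.
have [U0|U0] := eqVneq (\int[mu]_x u x) 0.
  rewrite ae_eq0_integral ?mule_ge0 ?poweR_ge0//.
  by apply: filterS (ge0_integral_eq0_ae mu_ u0 U0) => x ->; rewrite poweR0r// mul0e.
have [V0|V0] := eqVneq (\int[mu]_x v x) 0.
  rewrite ae_eq0_integral ?mule_ge0 ?poweR_ge0//.
  by apply: filterS (ge0_integral_eq0_ae mv v0 V0) => x ->; rewrite poweR0r// mule0.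
have {U0}Ugt : 0 < \int[mu]_x u x by rewrite lt0e U0 integral_ge0.
have {V0}Vgt : 0 < \int[mu]_x v x by rewrite lt0e V0 integral_ge0.
have [->|Uy] := eqVneq (\int[mu]_x u x) +oo.
  by rewrite poweRyr// gt0_mulye ?leey// poweR_gt0.
have [->|Vy] := eqVneq (\int[mu]_x v x) +oo.
  by rewrite poweRyr// gt0_muley ?leey// poweR_gt0.
set U := \int[mu]_x u x in Ugt Uy *; set V := \int[mu]_x v x in Vgt Vy *.
have UE : U = (fine U)%:E by rewrite fineK// ge0_fin_numE ?ltey// ltW.
have VE : V = (fine V)%:E by rewrite fineK// ge0_fin_numE ?ltey// ltW.
have U0 : (0 < fine U)%R by rewrite -lte_fin -UE.
have V0 : (0 < fine V)%R by rewrite -lte_fin -VE.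
pose iU := (fine U)^-1%:E; pose iV := (fine V)^-1%:E.
have iU0 : 0 <= iU by rewrite lee_fin invr_ge0 ltW.
have iV0 : 0 <= iV by rewrite lee_fin invr_ge0 ltW.
have uE x : u x = U * (iU * u x).
  by rewrite muleA {1}UE /iU -EFinM mulfV ?mul1e// gt_eqF.
have vE x : v x = V * (iV * v x).
  by rewrite muleA {1}VE /iV -EFinM mulfV ?mul1e// gt_eqF.
have step x : u x `^ a * v x `^ b <=
    U `^ a * V `^ b * (a%:E * (iU * u x) + b%:E * (iV * v x)).
  rewrite {1}uE {1}vE poweRM ?mule_ge0 ?(ltW Ugt)//.
  rewrite [X in _ * X]poweRM ?mule_ge0 ?(ltW Vgt)//.
  rewrite muleACA lee_wpmul2l ?mule_ge0 ?poweR_ge0//.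
  by apply: young_poweR => //; rewrite mule_ge0.
apply: le_trans (ge0_le_integral _ measurableT _ muv _ (fun x _ => step x)) _.
- by move=> x _; rewrite mule_ge0// poweR_ge0.
- by do ?[apply: measurable_funeM|apply: emeasurable_funD].
rewrite ge0_integralZl//; last 3 first.
- by do ?[apply: measurable_funeM|apply: emeasurable_funD].
- by move=> x _; rewrite adde_ge0 ?mule_ge0// lee_fin ltW.
- by rewrite mule_ge0 ?poweR_ge0.
rewrite ge0_integralD//; last 4 first.
- by move=> x _; rewrite ?mule_ge0// lee_fin ltW.
- by do ?[apply: measurable_funeM|apply: emeasurable_funD].
- by move=> x _; rewrite ?mule_ge0// lee_fin ltW.
- by do ?[apply: measurable_funeM|apply: emeasurable_funD].
rewrite !ge0_integralZl ?lee_fin ?(ltW a0) ?(ltW b0)//; last 4 first.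
- exact: measurable_funeM.
- by move=> x _; rewrite mule_ge0.
- exact: measurable_funeM.
- by move=> x _; rewrite mule_ge0.
have -> : iU * \int[mu]_x u x = 1.
  by rewrite -/U {1}UE /iU -EFinM mulVf// gt_eqF.
have -> : iV * \int[mu]_x v x = 1.
  by rewrite -/V {1}VE /iV -EFinM mulVf// gt_eqF.
by rewrite !mule1 -EFinD ab mule1.
Qed.

End hoelder_integral.

(* Indexed by the reciprocal exponent [t], so that Hoelder's inequality is
   additive in [t]; [t = 0] stands for the exponent [+oo]. *)
Definition rnorm {R : realType} d (T : measurableType d)
    (mu : {measure set T -> \bar R}) (t : R) (f : T -> \bar R) : \bar R :=
  'N[mu]_((t%:E)^-1)[f].

(** * Quasi-norms indexed by the reciprocal exponent *)

Section rnorm.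
Context {R : realType} d (T : measurableType d) (mu : {measure set T -> \bar R}).
Implicit Types (f g : T -> \bar R) (t : R).

Lemma rnorm_ge0 t f : 0 <= rnorm mu t f.
Proof. exact: Lnorm_ge0. Qed.

Lemma rnormE t f : (0 < t)%R -> (forall x, 0 <= f x) ->
  rnorm mu t f = (\int[mu]_x (f x `^ t^-1)) `^ t.
Proof.
move=> t0 f0; rewrite /rnorm inver gt_eqF// unlock invrK; congr (_ `^ _).
by apply: eq_integral => x _; rewrite gee0_abs.
Qed.

Lemma rnorm0_ge f : (forall x, 0 <= f x) -> \forall x \ae mu, f x <= rnorm mu 0 f.
Proof.
move=> f0; rewrite /rnorm inve0 unlock; case: ifPn => [_|muT].
  by apply: filterS (ess_sup_ge mu (abse \o f)) => x /=; rewrite gee0_abs.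
(* On a space of measure 0 the norm is 0 by convention, and every property holds almost
   everywhere. *)
exists setT; split => //; apply/eqP; rewrite eq_le measure_ge0 andbT.
by rewrite leNgt.
Qed.

Lemma rnorm0_le f (C : \bar R) : (forall x, 0 <= f x) -> 0 <= C ->
  (\forall x \ae mu, f x <= C) -> rnorm mu 0 f <= C.
Proof.
move=> f0 C0 fC; rewrite /rnorm inve0 unlock; case: ifPn => // _.
by apply/ess_supP; apply: filterS fC => x /=; rewrite gee0_abs.
Qed.

Lemma ae_le_rnorm t f g : (0 <= t)%R -> (forall x, 0 <= f x) -> (forall x, 0 <= g x) ->
  measurable_fun setT f -> measurable_fun setT g ->
  (\forall x \ae mu, f x <= g x) -> rnorm mu t f <= rnorm mu t g.
Proof.
rewrite le_eqVlt => /predU1P[<- f0 g0 _ _ fg|t0 f0 g0 mf mg fg].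
  apply: rnorm0_le => //; first exact: rnorm_ge0.
  by apply: filterS2 fg (rnorm0_ge g0) => x; exact: le_trans.
rewrite !rnormE//; apply: ge0_le_poweR; first exact: ltW.
  by apply: integral_ge0 => x _; exact: poweR_ge0.
apply: ae_ge0_le_integral => //.
- by move=> x _; exact: poweR_ge0.
- exact: measurable_fun_poweR.
- by move=> x _; exact: poweR_ge0.
- exact: measurable_fun_poweR.
by apply: filterS fg => x fg _; apply: ge0_le_poweR => //; rewrite invr_ge0 ltW.
Qed.

Lemma ge0_le_rnorm t f g : (0 <= t)%R -> (forall x, 0 <= f x) ->
  measurable_fun setT f -> measurable_fun setT g ->
  (forall x, f x <= g x) -> rnorm mu t f <= rnorm mu t g.
Proof.
move=> t0 f0 mf mg fg; apply: ae_le_rnorm => //.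
  by move=> x; exact: le_trans (fg x).
exact: nearW.
Qed.

(** The constant may be [+oo], because it will be the essential supremum of another function. *)
Lemma rnormZl_le t f (C : \bar R) : (0 <= t)%R -> 0 <= C ->
  measurable_fun setT f -> (forall x, 0 <= f x) ->
  rnorm mu t (fun x => C * f x) <= C * rnorm mu t f.
Proof.
rewrite le_eqVlt => /predU1P[<- C0 mf f0|t0 C0 mf f0].
  apply: rnorm0_le => [x||]; rewrite ?mule_ge0 ?rnorm_ge0//.
  by apply: filterS (rnorm0_ge f0) => x; exact: lee_wpmul2l.
rewrite !rnormE//; last by move=> x; rewrite mule_ge0.
under eq_integral do rewrite poweRM//.
rewrite ge0_integralZl ?poweR_ge0//; last 2 first.
- exact: measurable_fun_poweR.
- by move=> x _; exact: poweR_ge0.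
rewrite poweRM ?poweR_ge0 ?integral_ge0//; last by move=> x _; exact: poweR_ge0.
by rewrite poweRVK// gt_eqF.
Qed.

Lemma rnormM0 t f g : (0 <= t)%R ->
  measurable_fun setT f -> measurable_fun setT g ->
  (forall x, 0 <= f x) -> (forall x, 0 <= g x) ->
  rnorm mu t (fun x => f x * g x) <= rnorm mu 0 f * rnorm mu t g.
Proof.
move=> t0 mf mg f0 g0.
apply: le_trans (rnormZl_le t0 (rnorm_ge0 0 f) mg g0).
apply: ae_le_rnorm => //.
- by move=> x; rewrite mule_ge0.
- by move=> x; rewrite mule_ge0// rnorm_ge0.
- exact: emeasurable_funM.
- exact: measurable_funeM.
- by apply: filterS (rnorm0_ge f0) => x fx; exact: lee_wpmul2r.
Qed.

Lemma rnormM s t f g : (0 <= s)%R -> (0 <= t)%R ->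
  measurable_fun setT f -> measurable_fun setT g ->
  (forall x, 0 <= f x) -> (forall x, 0 <= g x) ->
  rnorm mu (s + t) (fun x => f x * g x) <= rnorm mu s f * rnorm mu t g.
Proof.
rewrite le_eqVlt => /predU1P[<- t0 mf mg f0 g0|s0].
  by rewrite add0r; exact: rnormM0.
rewrite le_eqVlt => /predU1P[<- mf mg f0 g0|t0 mf mg f0 g0].
  rewrite addr0 muleC; under [X in rnorm _ _ X]eq_fun do rewrite muleC.
  by apply: rnormM0 => //; exact: ltW.
have st0 : (0 < s + t)%R by exact: addr_gt0.
rewrite !rnormE//; last by move=> x; rewrite mule_ge0.
(* These weights turn both $f^{1/s}$ and $g^{1/t}$ into powers with the common exponent
   $1/(s+t)$. *)
have := @hoelder_integral _ _ _ mu (s / (s + t)) (t / (s + t))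
  (fun x => f x `^ s^-1) (fun x => g x `^ t^-1).
rewrite !divr_gt0// -mulrDl mulfV ?gt_eqF//.
move=> /(_ isT isT erefl (measurable_fun_poweR _ mf) (measurable_fun_poweR _ mg)).
move=> /(_ (fun=> poweR_ge0 _ _) (fun=> poweR_ge0 _ _)).
have e (h : T -> \bar R) (r : R) x : (0 < r)%R ->
    (h x `^ r^-1) `^ (r / (s + t)) = h x `^ (s + t)^-1.
  by move=> r0; rewrite -poweRrM mulKf// gt_eqF.
under eq_integral do rewrite !e// -poweRM//.
move=> /(ge0_le_poweR (ltW st0)) => /(_ _)/le_trans; apply.
  by apply: integral_ge0 => x _; exact: poweR_ge0.
by rewrite poweRM ?poweR_ge0// -!poweRrM !divfK// gt_eqF.
Qed.

Lemma rnorm_poweR_le t (a : R) f : (0 <= t)%R -> (0 < a)%R ->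
  measurable_fun setT f -> (forall x, 0 <= f x) ->
  rnorm mu (a * t) (fun x => f x `^ a) <= rnorm mu t f `^ a.
Proof.
rewrite le_eqVlt => /predU1P[<- a0 mf f0|t0 a0 mf f0].
  rewrite mulr0; apply: rnorm0_le => [x||]; rewrite ?poweR_ge0//.
  by apply: filterS (rnorm0_ge f0) => x; apply: ge0_le_poweR => //; exact: ltW.
rewrite !rnormE ?mulr_gt0//; last by move=> x; exact: poweR_ge0.
rewrite -poweRrM (mulrC a); under eq_integral do rewrite -poweRrM.
by rewrite invfM mulrCA mulfV ?mulr1// gt_eqF.
Qed.

Lemma rnorm_prod_le (I : Type) (s : seq I) (t : I -> R) (F : I -> T -> \bar R) :
  (forall i, 0 <= t i)%R -> (forall i, measurable_fun setT (F i)) ->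
  (forall i x, 0 <= F i x) ->
  rnorm mu (\sum_(i <- s) t i) (fun x => \prod_(i <- s) F i x) <=
  \prod_(i <- s) rnorm mu (t i) (F i).
Proof.
move=> t0 mF F0; elim: s => [|i s IH].
  (* The empty product has reciprocal exponent 0, and the essential supremum of the constant 1 is at
     most 1; it is 0 on a null space. *)
  rewrite !big_nil; apply: rnorm0_le => // [x|]; first by rewrite big_nil.
  by apply: nearW => x; rewrite big_nil.
rewrite !big_cons; under [X in rnorm _ _ X]eq_fun do rewrite big_cons.
apply: le_trans (rnormM _ _ _ _ _ _) _ => //.
- by rewrite sumr_ge0.
- elim: s {IH} => [|j s IH].
    by under eq_fun do rewrite big_nil; exact: measurable_cst.
  by under eq_fun do rewrite big_cons; exact: emeasurable_funM.
- by move=> x; exact: prode_ge0.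
- by rewrite lee_wpmul2l// rnorm_ge0.
Qed.

End rnorm.

(** * Norms depending on a parameter: measurability and null sections *)

Section iterated_rnorm.
Context {R : realType} d1 d2 (T1 : measurableType d1) (T2 : measurableType d2).
Implicit Types (t : R) (g h : T1 * T2 -> \bar R).

(** For [0 < t] this is part of Tonelli's theorem. For [t = 0] and $a\ge0$, the essential supremum
    of a section exceeds $a$ exactly when the section of $\{g>a\}$ has positive measure, and that
    measure depends measurably on [x]. *)
Lemma measurable_rnorm (m2 : {sigma_finite_measure set T2 -> \bar R}) t g :
  (0 <= t)%R -> measurable_fun setT g -> (forall z, 0 <= g z) ->
  measurable_fun setT (fun x => rnorm m2 t (fun y => g (x, y))).
Proof.
rewrite le_eqVlt => /predU1P[<- mg g0|t0 mg g0]; last first.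
  under eq_fun do rewrite rnormE//.
  apply: measurable_fun_poweR.
  apply: (measurable_fun_fubini_tonelli_F (fun z => g z `^ t^-1)) => //.
    exact: measurable_fun_poweR.
  by move=> z; exact: poweR_ge0.
move=> mT; apply: (measurability _ (ErealGenOInfty.measurableE R)) => //.
move=> _ [_ [a ->] <-]; apply: measurableI => //.
have [a0|a0] := ltP a 0%R.
  rewrite (_ : _ @^-1` _ = setT)//; apply/seteqP; split=> // x _ /=.
  by rewrite in_itv/= andbT (lt_le_trans _ (rnorm_ge0 _ _ _)).
pose A := [set z | a%:E < g z].
have mA : measurable A.
  by rewrite -[A]setTI; exact: emeasurable_fun_o_infty.
rewrite (_ : _ @^-1` _ = setT `&` [set x | 0 < (m2 \o xsection A) x]).
  by apply: emeasurable_fun_o_infty => //; exact: measurable_fun_xsection.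
have mgx x : measurable_fun setT (fun y => g (x, y)).
  exact: measurableT_comp.
have AE x : xsection A x = (fun y => g (x, y)) @^-1` `]a%:E, +oo[%classic.
  apply/seteqP; split => y /=; rewrite /xsection/= inE /A/= in_itv/= andbT//.
rewrite setTI; apply/seteqP; split => x /=; rewrite in_itv/= andbT AE.
  apply: contraTT; rewrite -leNgt measure_le0 => /eqP/ae_le_measureP.
  move=> /(_ (mgx x)) gxa; rewrite -leNgt; apply: rnorm0_le => //.
apply: contraTT; rewrite -!leNgt => Fa; rewrite measure_le0; apply/eqP.
apply/ae_le_measureP => //.
by apply: filterS (rnorm0_ge m2 (fun y => g0 (x, y))) => y /le_trans; exact.
Qed.

(** The measures of the sections in either direction have the same integral, by Tonelli's
    theorem. *)
Lemma ae_section_eq0 (m1 : {sigma_finite_measure set T1 -> \bar R})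
    (m2 : {sigma_finite_measure set T2 -> \bar R}) (A : set (T1 * T2)) :
  measurable A -> (forall y, m1 (ysection A y) = 0) ->
  \forall x \ae m1, m2 (xsection A x) = 0.
Proof.
move=> mA A0; have := indic_fubini_tonelli m1 m2 mA.
rewrite indic_fubini_tonelli_FE// indic_fubini_tonelli_GE//.
under [RHS]eq_integral do rewrite /= A0.
rewrite integral0 => /ge0_integral_eq0_ae; apply => //.
exact: measurable_fun_xsection.
Qed.

End iterated_rnorm.

(** * Minkowski's integral inequality *)

Section minkowski_integral.
Context {R : realType} d1 d2 (T1 : measurableType d1) (T2 : measurableType d2).
Variables (m1 : {sigma_finite_measure set T1 -> \bar R})
  (m2 : {sigma_finite_measure set T2 -> \bar R}).
Implicit Types (t : R) (g h : T1 * T2 -> \bar R).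

(** Allows a bound to be proved only for minorants with finite integral, where a power of that
    integral may be cancelled. *)
Lemma sigma_finite_integral_le (W : T1 -> \bar R) (C : \bar R) :
  measurable_fun setT W -> (forall x, 0 <= W x) ->
  (forall V : T1 -> \bar R, measurable_fun setT V ->
    (forall x, 0 <= V x <= W x) -> \int[m1]_x V x < +oo ->
    \int[m1]_x V x <= C) ->
  \int[m1]_x W x <= C.
Proof.
move=> mW W0 H.
have /sigma_finiteP[F [FT ndF mF]] := sigma_finiteT m1.
(* Truncation in height and to a set of finite measure; the integral is at most [k] times the
   measure of [F k]. *)
pose V (k : nat) x : \bar R := mine (W x) k%:R%:E * (\1_(F k) x)%:E.
have V0 k x : 0 <= V k x.
  by rewrite /V mule_ge0// ?lee_fin// le_min W0/= lee_fin.
have mV k : measurable_fun setT (V k).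
  apply: emeasurable_funM; first exact: measurable_mine.
  by apply/measurable_EFinP; apply: measurable_indic; exact: (mF k).1.
have VW k x : V k x <= W x.
  rewrite /V indicE; case: (x \in F k); last by rewrite mule0.
  by rewrite mule1 ge_min lexx.
have ndV x : nondecreasing_seq (V ^~ x).
  move=> i j ij; rewrite /V lee_pmul//.
  - by rewrite le_min W0/= lee_fin.
  - rewrite le_min ge_min lexx/= ge_min [X in _ || X](_ : _ = true) ?orbT//.
    by rewrite lee_fin ler_nat.
  rewrite lee_fin !indicE ler_nat.
  have [|//] := boolP (x \in F i); rewrite inE => Fi.
  by rewrite mem_set//; move/subsetPset: (ndF _ _ ij); exact.
have VcvgW x : V ^~ x @ \oo --> W x.
  have [k0 _ Fk0] : (\bigcup_k F k) x by rewrite -FT.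
  have Fk k : (k0 <= k)%N -> (\1_(F k) x)%:E = 1 :> \bar R.
    by move=> k0k; rewrite indicE mem_set//; move/subsetPset: (ndF _ _ k0k); exact.
  have := W0 x; case Wx: (W x) => [w| |]// _.
    apply: cvg_near_cst; near=> k.
    rewrite /V Wx Fk ?mule1; last by near: k; exists k0.
    rewrite -EFin_min min_l//.
    by near: k; exact: nbhs_infty_ger.
  apply/cvgeyPge => A; near=> k.
  rewrite /V Wx Fk ?mule1; last by near: k; exists k0.
  rewrite min_r ?leey// lee_fin.
  by near: k; exact: nbhs_infty_ger.
have Vy k : \int[m1]_x V k x < +oo.
  apply: (@le_lt_trans _ _ (\int[m1]_x (k%:R%:E * (\1_(F k) x)%:E))).
    apply: ge0_le_integral => //.
      apply: measurable_funeM.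
      by apply/measurable_EFinP; apply: measurable_indic; exact: (mF k).1.
    by move=> x _; rewrite lee_wpmul2r ?lee_fin// ge_min lexx orbT.
  have [mFk Fky] := mF k.
  rewrite ge0_integralZl//; last by apply/measurable_EFinP; exact: measurable_indic.
  rewrite integral_indic// setIT lte_mul_pinfty//.
rewrite (_ : \int[m1]_x W x = \int[m1]_x limn (V ^~ x)); last first.
  by apply: eq_integral => x _; apply/esym/cvg_lim.
rewrite monotone_convergence//; apply: lime_le.
  apply: ereal_nondecreasing_is_cvgn => i j ij; apply: ge0_le_integral => //.
  by move=> x _; exact: ndV.
by apply: nearW => k; apply: H => // x; rewrite V0 VW.
Unshelve. all: by end_near. Qed.

(* Testing [V <= (int h)^s] against [V^(1-1/s)]: Tonelli and Hoelder in [x]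
   bound [int V] by the right-hand side times [(int V)^(1-1/s)]. *)
Lemma minkowski_integral (s : R) h : (1 <= s)%R ->
  measurable_fun setT h -> (forall z, 0 <= h z) ->
  \int[m1]_x (\int[m2]_y h (x, y)) `^ s <=
  (\int[m2]_y (\int[m1]_x (h (x, y) `^ s)) `^ s^-1) `^ s.
Proof.
rewrite le_eqVlt => /predU1P[<- mh h0|s1 mh h0].
  rewrite invr1.
  have I0 : 0 <= \int[m2]_y \int[m1]_x h (x, y).
    by apply: integral_ge0 => y _; exact: integral_ge0.
  under eq_integral do rewrite poweRe1 ?integral_ge0//.
  under [in leRHS]eq_integral => y _.
    under eq_integral do rewrite poweRe1//.
    rewrite poweRe1 ?integral_ge0//; over.
  by rewrite poweRe1// fubini_tonelli.
have s0 : (0 < s)%R by exact: lt_trans s1.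
have sn0 : s != 0%R by rewrite gt_eqF.
have b0 : (0 < 1 - s^-1)%R by rewrite subr_gt0 invf_lt1.
have hs0 x y : 0 <= h (x, y) `^ s by exact: poweR_ge0.
have mhs : measurable_fun setT (fun z => h z `^ s) by exact: measurable_fun_poweR.
set M := \int[m2]_y _.
have M0 : 0 <= M by apply: integral_ge0 => y _; exact: poweR_ge0.
have mH : measurable_fun setT (fun x => \int[m2]_y h (x, y)).
  exact: (measurable_fun_fubini_tonelli_F h).
have mG : measurable_fun setT (fun y => \int[m1]_x (h (x, y) `^ s)).
  apply: (measurable_fun_fubini_tonelli_G (fun z => h z `^ s)) => // z.
  exact: poweR_ge0.
have H0 x : 0 <= \int[m2]_y h (x, y) by exact: integral_ge0.
apply: sigma_finite_integral_le.
- exact: measurable_fun_poweR.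
- by move=> x; exact: poweR_ge0.
move=> V mV VW Vy.
have V0 x : 0 <= V x by case/andP: (VW x).
have [->|Vn0] := eqVneq (\int[m1]_x V x) 0; first exact: poweR_ge0.
have Vgt0 : 0 < \int[m1]_x V x by rewrite lt0e Vn0 integral_ge0.
have key : \int[m1]_x V x <= M * (\int[m1]_x V x) `^ (1 - s^-1).
  apply: (@le_trans _ _ (\int[m1]_x \int[m2]_y (h (x, y) * V x `^ (1 - s^-1)))).
    apply: ge0_le_integral => //.
      apply: (measurable_fun_fubini_tonelli_F
        (fun z : T1 * T2 => h z * V z.1 `^ (1 - s^-1))).
        apply: emeasurable_funM => //; apply: measurable_fun_poweR.
        exact: measurableT_comp.
      by move=> z; rewrite mule_ge0// poweR_ge0.
    move=> x _; rewrite ge0_integralZr ?poweR_ge0//; last exact: measurableT_comp.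
    have [Vx0|Vxn0] := eqVneq (V x) 0.
      by rewrite Vx0 mule_ge0// poweR_ge0.
    rewrite -[leLHS]poweRe1// -[X in _ `^ X](subrKC s^-1%R) poweRD; last first.
      by apply: nneg_neq0_poweRD_def => //; rewrite ?invr_ge0 ltW.
    (* Here $V=V^{1/s}V^{1-1/s}$, and the first factor is at most $\int h$ by the choice of [V]. *)
    apply: lee_wpmul2r; first exact: poweR_ge0.
    rewrite -[leRHS](poweRK sn0)//; apply: ge0_le_poweR => //.
      by rewrite invr_ge0 ltW.
    by case/andP: (VW x).
  rewrite (fubini_tonelli (fun z : T1 * T2 => h z * V z.1 `^ (1 - s^-1))); last 2 first.
  - apply: emeasurable_funM => //; apply: measurable_fun_poweR.
    exact: measurableT_comp.
  - by move=> z; rewrite mule_ge0// poweR_ge0.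
  rewrite -ge0_integralZr ?poweR_ge0//; last 2 first.
  - exact: measurable_fun_poweR.
  - by move=> y _; exact: poweR_ge0.
  apply: ge0_le_integral => //.
  - by move=> y _; apply: integral_ge0 => x _; rewrite mule_ge0// poweR_ge0.
  - apply: (measurable_fun_fubini_tonelli_G
      (fun z : T1 * T2 => h z * V z.1 `^ (1 - s^-1))).
      apply: emeasurable_funM => //; apply: measurable_fun_poweR.
      exact: measurableT_comp.
    by move=> z; rewrite mule_ge0// poweR_ge0.
  - by apply: emeasurable_funM => //; exact: measurable_fun_poweR.
  move=> y _ /=.
  (* Hoelder's inequality in [x] for a fixed [y], with $h=(h^s)^{1/s}$. *)
  have := @hoelder_integral _ _ _ m1 s^-1 (1 - s^-1) (fun x => h (x, y) `^ s) V.
  rewrite invr_gt0 s0 b0 subrKC => /(_ isT isT erefl).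
  under eq_integral do rewrite poweRK//.
  by apply => //; exact: (measurableT_comp mhs).
set I := \int[m1]_x V x in Vy Vn0 Vgt0 key *.
have IE : I `^ s^-1 * I `^ (1 - s^-1) = I.
  rewrite -poweRD ?subrKC ?poweRe1 ?(ltW Vgt0)//.
  by apply: nneg_neq0_poweRD_def => //; rewrite ?invr_ge0 ltW.
rewrite -[leLHS](poweRVK sn0) ?(ltW Vgt0)//; apply: ge0_le_poweR.
- exact: ltW.
- exact: poweR_ge0.
(* The common factor $I^{1-1/s}$ is positive and finite, so it cancels and leaves $I^{1/s}\le M$. *)
move: key; rewrite -{1}IE lee_pmul2r//.
  by rewrite fin_num_poweR// ge0_fin_numE// ltW.
by rewrite poweR_gt0.
Qed.

(** For [0 < t1] this is the preceding inequality for $h^{1/t_2}$ with $s=t_2/t_1$, raised to the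
    power $t_1$. *)
Lemma rnorm_minkowski (t1 t2 : R) h : (0 <= t1)%R -> (t1 <= t2)%R ->
  measurable_fun setT h -> (forall z, 0 <= h z) ->
  rnorm m1 t1 (fun x => rnorm m2 t2 (fun y => h (x, y))) <=
  rnorm m2 t2 (fun y => rnorm m1 t1 (fun x => h (x, y))).
Proof.
move=> t10 t12 mh h0; have t20 := le_trans t10 t12.
have mhS : measurable_fun setT (fun z : T2 * T1 => h (z.2, z.1)).
  by apply: measurableT_comp => //; exact: measurable_swap.
have mG (t : R) : (0 <= t)%R ->
    measurable_fun setT (fun y => rnorm m1 t (fun x => h (x, y))).
  by move=> t0; exact: (measurable_rnorm m1 (g := fun z : T2 * T1 => h (z.2, z.1))).
have h0x x : forall y, 0 <= h (x, y) by [].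
have h0y y : forall x, 0 <= h (x, y) by [].
move: t10; rewrite le_eqVlt => /predU1P[t10|t10].
  move: t12 mG; rewrite -t10 => _ mG.
  apply: rnorm0_le => [x||]; [exact: rnorm_ge0|exact: rnorm_ge0|].
  (* The points where [h] exceeds its essential supremum in [x]. Its sections at fixed [y] are null,
     hence so are almost all sections at fixed [x], which gives the pointwise bound needed inside
     the norm in [y]. *)
  pose A := [set z : T1 * T2 | rnorm m1 0 (fun x => h (x, z.2)) < h z].
  have mA : measurable A.
    rewrite -[A]setTI; apply: measurable_lte => //.
    by apply: (measurableT_comp (mG 0%R (lexx _))); exact: measurable_snd.
  have /(ae_section_eq0 m2 mA) : forall y, m1 (ysection A y) = 0.
    move=> y; have mhy : measurable_fun setT (fun x => h (x, y)).
      exact: measurableT_comp.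
    have /(ae_le_measureP _ _ mhy) <- := rnorm0_ge m1 (h0y y).
    congr (m1 _); apply/seteqP; split => x; rewrite /ysection/= inE /A/= in_itv/= andbT//.
  apply: filterS => x Ax; apply: ae_le_rnorm => //.
  - by move=> y; exact: rnorm_ge0.
  - exact: measurableT_comp.
  - exact: mG.
  exists (xsection A x); split => //; first exact: measurable_xsection.
  move=> y /= /negP; rewrite -ltNge => hy.
  by rewrite /xsection/= inE.
have {}t20 : (0 < t2)%R by exact: lt_le_trans t12.
have t1n0 : t1 != 0%R by rewrite gt_eqF.
have t2n0 : t2 != 0%R by rewrite gt_eqF.
rewrite !rnormE//; try by move=> ?; exact: rnorm_ge0.
under eq_integral do rewrite rnormE// -poweRrM.
under [in leRHS]eq_integral do rewrite rnormE// -poweRrM.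
have /(minkowski_integral (h := fun z => h z `^ t2^-1)) : (1 <= t2 / t1)%R.
  by rewrite ler_pdivlMr// mul1r.
move=> /(_ (measurable_fun_poweR _ mh) (fun=> poweR_ge0 _ _)).
under [in leRHS]eq_integral do under eq_integral do rewrite -poweRrM mulKf//.
rewrite invf_div.
move=> /(ge0_le_poweR (ltW t10)) => /(_ _)/le_trans; apply.
  by apply: integral_ge0 => x _; exact: poweR_ge0.
by rewrite -poweRrM divfK.
Qed.

End minkowski_integral.

(** * Iterated norms: reordering, products and powers *)

Section iterated_norms.
Context {R : realType} {n : nat} {d : 'I_n -> measure_display}.
Context {T : forall i, measurableType (d i)}.
Variable mu : forall i, {sigma_finite_measure set (T i) -> \bar R}.
Implicit Types (f g : pispace T -> \bar R) (x : pispace T) (t : R).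
Implicit Types (c : R * 'I_n) (s : seq (R * 'I_n)).

Definition partial_rnorm c f : pispace T -> \bar R :=
  fun x => rnorm (mu c.2) c.1 (fun u : T c.2 => f (subst_coord x u)).

(** The head of the list is the innermost norm. Each variable is paired with its reciprocal
    exponent, so that reordering the norms is permuting the list. *)
Definition iter_rnorm s f : pispace T -> \bar R :=
  foldl (fun g c => partial_rnorm c g) f s.

Lemma measurable_fun_subst_coord k f : measurable_fun setT f ->
  measurable_fun setT (fun z : pispace T * T k => f (subst_coord z.1 z.2)).
Proof.
by move=> mf; exact: (measurableT_comp mf (@measurable_subst_coord _ _ T k)).
Qed.

Lemma measurable_fun_section k f x : measurable_fun setT f ->
  measurable_fun setT (fun u : T k => f (subst_coord x u)).
Proof.
move=> mf; have mx : measurable_fun setT (fun u : T k => (x, u)).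
  exact: measurable_fun_pair.
exact: (measurableT_comp (measurable_fun_subst_coord (k := k) mf) mx).
Qed.

Lemma subst_coordC x (j k : 'I_n) (u : T j) (v : T k) : j != k ->
  subst_coord (subst_coord x u) v = subst_coord (subst_coord x v) u.
Proof.
move=> jk; apply: functional_extensionality_dep => i; rewrite /subst_coord.
have [ij|ij] := eqVneq j i.
  by subst i; rewrite dfwithout ?dfwithin// eq_sym.
have [ik|ik] := eqVneq k i.
  by subst i; rewrite dfwithin dfwithout// dfwithin.
by rewrite !dfwithout.
Qed.

Lemma partial_rnorm_ge0 c f x : 0 <= partial_rnorm c f x.
Proof. exact: rnorm_ge0. Qed.

Lemma measurable_partial_rnorm c f : (0 <= c.1)%R -> measurable_fun setT f ->
  (forall x, 0 <= f x) -> measurable_fun setT (partial_rnorm c f).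
Proof.
move=> c0 mf f0; apply: (measurable_rnorm (mu c.2)
  (g := fun z : pispace T * T c.2 => f (subst_coord z.1 z.2))) => //.
exact: measurable_fun_subst_coord.
Qed.

Lemma le_partial_rnorm c f g : (0 <= c.1)%R ->
  measurable_fun setT f -> measurable_fun setT g ->
  (forall x, 0 <= f x <= g x) ->
  forall x, partial_rnorm c f x <= partial_rnorm c g x.
Proof.
move=> c0 mf mg fg x; apply: ge0_le_rnorm => //.
- by move=> u; case/andP: (fg (subst_coord x u)).
- exact: measurable_fun_section.
- exact: measurable_fun_section.
- by move=> u; case/andP: (fg (subst_coord x u)).
Qed.

Lemma partial_rnorm_swap c c' f x : (0 <= c.1)%R -> (c.1 <= c'.1)%R -> c.2 != c'.2 ->
  measurable_fun setT f -> (forall y, 0 <= f y) ->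
  partial_rnorm c (partial_rnorm c' f) x <= partial_rnorm c' (partial_rnorm c f) x.
Proof.
move=> c0 cc' ck mf f0.
have := @rnorm_minkowski _ _ _ _ _ (mu c.2) (mu c'.2) c.1 c'.1
  (fun z => f (subst_coord (subst_coord x z.1) z.2)) c0 cc'.
rewrite (_ : rnorm (mu c'.2) _ _ = partial_rnorm c' (partial_rnorm c f) x); last first.
  rewrite /partial_rnorm; congr rnorm; apply/funext => v.
  by congr rnorm; apply/funext => u; rewrite subst_coordC.
apply => //.
apply: (measurableT_comp mf); apply: measurable_to_pispace => j.
rewrite /subst_coord; have [jk'|jk'] := eqVneq c'.2 j.
  by subst j; under eq_fun do rewrite dfwithin; exact: measurable_snd.
under eq_fun do rewrite dfwithout//.
have [jk|jk] := eqVneq c.2 j.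
  by subst j; under eq_fun do rewrite dfwithin; exact: measurable_fst.
by under eq_fun do rewrite dfwithout//; exact: measurable_cst.
Qed.

Lemma iter_rnorm_ge0 s f : (forall x, 0 <= f x) -> forall x, 0 <= iter_rnorm s f x.
Proof.
elim: s f => //= c s IH f f0 x; apply: IH => y; exact: partial_rnorm_ge0.
Qed.

Lemma le_iter_rnorm s f g : all (fun c => 0 <= c.1)%R s ->
  measurable_fun setT f -> measurable_fun setT g ->
  (forall x, 0 <= f x <= g x) ->
  forall x, iter_rnorm s f x <= iter_rnorm s g x.
Proof.
elim: s f g => [f g _ _ _ fg x|c s IH f g /= /andP[c0 s0] mf mg fg].
  by case/andP: (fg x).
have f0 x : 0 <= f x by case/andP: (fg x).
have g0 x : 0 <= g x by case/andP: (fg x) => /le_trans; exact.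
apply: IH => //; [exact: measurable_partial_rnorm|exact: measurable_partial_rnorm|].
by move=> x; rewrite partial_rnorm_ge0; exact: le_partial_rnorm.
Qed.

Lemma iter_rnorm_cat s1 s2 f :
  iter_rnorm (s1 ++ s2) f = iter_rnorm s2 (iter_rnorm s1 f).
Proof. by rewrite /iter_rnorm foldl_cat. Qed.

Lemma measurable_iter_rnorm s f : all (fun c => 0 <= c.1)%R s ->
  measurable_fun setT f -> (forall x, 0 <= f x) ->
  measurable_fun setT (iter_rnorm s f).
Proof.
elim: s f => //= c s IH f /andP[c0 s0] mf f0; apply: IH => //.
  exact: measurable_partial_rnorm.
by move=> x; exact: partial_rnorm_ge0.
Qed.

(** The entry [c] has the smallest exponent, so each exchange that moves it outwards can only
    increase the norm. *)
Lemma iter_rnorm_rcons_ge c s f x : (0 <= c.1)%R -> all (fun b => 0 <= b.1)%R s ->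
  all (fun b => b.1 <= c.1)%R s -> c.2 \notin [seq b.2 | b <- s] ->
  measurable_fun setT f -> (forall x, 0 <= f x) ->
  iter_rnorm (c :: s) f x <= iter_rnorm (rcons s c) f x.
Proof.
move=> c0; elim: s f x => //= b s IH f x /andP[b0 s0] /andP[bc sc].
rewrite inE negb_or => /andP[cb cs] mf f0.
have mb : measurable_fun setT (partial_rnorm b f) by exact: measurable_partial_rnorm.
have mc : measurable_fun setT (partial_rnorm c f) by exact: measurable_partial_rnorm.
apply: (@le_trans _ _ (iter_rnorm s (partial_rnorm c (partial_rnorm b f)) x)).
  apply: le_iter_rnorm => //.
  - by apply: measurable_partial_rnorm => // y; exact: partial_rnorm_ge0.
  - by apply: measurable_partial_rnorm => // y; exact: partial_rnorm_ge0.
  move=> y; rewrite partial_rnorm_ge0/=; apply: partial_rnorm_swap => //.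
  by rewrite eq_sym.
by apply: (IH (partial_rnorm b f)) => // y; exact: partial_rnorm_ge0.
Qed.

(* Minkowski's inequality makes the norm smaller whenever a smaller exponent
   moves inside, so the nonincreasing order of the exponents is extremal. *)
Lemma iter_rnorm_sorted_ge s s' f x : perm_eq s s' ->
  pairwise (fun b c => b.1 <= c.1)%R s' -> uniq [seq b.2 | b <- s'] ->
  all (fun b => 0 <= b.1)%R s' ->
  measurable_fun setT f -> (forall x, 0 <= f x) ->
  iter_rnorm s f x <= iter_rnorm s' f x.
Proof.
elim: s s' f x => [|c s IH] s' f x ss'.
  by move: ss'; rewrite perm_sym => /perm_nilP ->.
have cs' : c \in s' by rewrite -(perm_mem ss') mem_head.
(* The innermost entry [c] of [s] is located in the sorted list. The induction hypothesis compares
   the other entries with [c] kept innermost; then [c] moves out past [s1], whose reciprocal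
   exponents are at most its own. *)
case/splitPr: cs' ss' => s1 s2 ss'.
rewrite pairwise_cat pairwise_cons => /and3P[s1cs2 ps1 /andP[cs2 ps2]].
rewrite map_cat/= => u.
rewrite all_cat/= => /andP[s10 /andP[c0 s20]] mf f0.
have ss : perm_eq s (s1 ++ s2).
  by rewrite -(perm_cons c) (permPl ss') -cat1s perm_catCA.
have s1c : all (fun b => b.1 <= c.1)%R s1.
  apply/allP => b bs1; move/allrelP: s1cs2 => /(_ b c bs1); apply.
  exact: mem_head.
have s1s2 : allrel (fun b c => b.1 <= c.1)%R s1 s2.
  by apply/allrelP => b e bs1 es2; move/allrelP: s1cs2; apply=> //; rewrite inE es2 orbT.
have cns1 : c.2 \notin [seq b.2 | b <- s1].
  by move: u; rewrite cat_uniq/= negb_or => /and3P[_ /andP[]].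
have mc : measurable_fun setT (partial_rnorm c f) by exact: measurable_partial_rnorm.
apply: (@le_trans _ _ (iter_rnorm (s1 ++ s2) (partial_rnorm c f) x)).
  apply: IH => //.
  - by rewrite pairwise_cat s1s2 ps1 ps2.
  - move: u; rewrite map_cat -cat1s uniq_catCA cat_uniq => /and3P[_ _].
    by rewrite /=.
  - by rewrite all_cat s10.
  - by move=> y; exact: partial_rnorm_ge0.
rewrite -cat_rcons !iter_rnorm_cat; apply: le_iter_rnorm => //.
- by apply: measurable_iter_rnorm => // y; exact: partial_rnorm_ge0.
- by apply: measurable_iter_rnorm => //; rewrite all_rcons c0.
move=> y; rewrite iter_rnorm_ge0/=; last by move=> z; exact: partial_rnorm_ge0.
exact: (iter_rnorm_rcons_ge (c := c)).
Qed.

Lemma measurable_fun_prode (I : Type) (r : seq I) (F : I -> pispace T -> \bar R) :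
  (forall i, measurable_fun setT (F i)) ->
  measurable_fun setT (fun x => \prod_(i <- r) F i x).
Proof.
move=> mF; elim: r => [|i r IH].
  by under eq_fun do rewrite big_nil; exact: measurable_cst.
by under eq_fun do rewrite big_cons; exact: emeasurable_funM.
Qed.

(** All factors have their variables in the same order, so Hoelder's inequality in the innermost
    variable leaves a product of partial norms to which induction applies. *)
Lemma iter_rnorm_prod_le (I : Type) (r : seq I) (t : I -> 'I_n -> R)
    (F : I -> pispace T -> \bar R) (ks : seq 'I_n) x :
  (forall i k, 0 <= t i k)%R -> (forall i, measurable_fun setT (F i)) ->
  (forall i x, 0 <= F i x) ->
  iter_rnorm [seq (\sum_(i <- r) t i k, k)%R | k <- ks]
    (fun x => \prod_(i <- r) F i x) x <=
  \prod_(i <- r) iter_rnorm [seq (t i k, k) | k <- ks] (F i) x.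
Proof.
move=> t0; elim: ks F => // k ks IH F mF F0 /=.
have mp : measurable_fun setT
    (fun x => \prod_(i <- r) partial_rnorm (t i k, k) (F i) x).
  by apply: measurable_fun_prode => i; apply: measurable_partial_rnorm => /=.
have st0 j : (0 <= \sum_(i <- r) t i j)%R by exact: sumr_ge0.
apply: le_trans (IH (fun i => partial_rnorm (t i k, k) (F i)) _ _); last 2 first.
- by move=> i; apply: measurable_partial_rnorm => /=.
- by move=> i y; exact: partial_rnorm_ge0.
apply: le_iter_rnorm => //.
- by rewrite all_map; apply/allP => j _ /=.
- apply: measurable_partial_rnorm => //=; first exact: measurable_fun_prode.
  by move=> y; exact: prode_ge0.
move=> y; rewrite partial_rnorm_ge0/=.
apply: (rnorm_prod_le (mu k) r (F := fun i u => F i (subst_coord y u))) => //.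
by move=> i; exact: measurable_fun_section.
Qed.

Lemma iter_rnorm_poweR_le (a : R) (t : 'I_n -> R) f (ks : seq 'I_n) x :
  (0 < a)%R -> (forall k, 0 <= t k)%R -> measurable_fun setT f ->
  (forall x, 0 <= f x) ->
  iter_rnorm [seq (a * t k, k)%R | k <- ks] (fun x => f x `^ a) x <=
  iter_rnorm [seq (t k, k) | k <- ks] f x `^ a.
Proof.
move=> a0 t0; elim: ks f => // k ks IH f mf f0 /=.
have at0 j : (0 <= a * t j)%R by rewrite mulr_ge0// ltW.
have mk : measurable_fun setT (partial_rnorm (t k, k) f).
  by apply: measurable_partial_rnorm => /=.
apply: le_trans (IH (partial_rnorm (t k, k) f) _ _) => //; last first.
  by move=> y; exact: partial_rnorm_ge0.
apply: le_iter_rnorm => //.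
- by rewrite all_map; apply/allP => j _ /=.
- apply: measurable_partial_rnorm => //=; first exact: measurable_fun_poweR.
  by move=> y; exact: poweR_ge0.
- exact: measurable_fun_poweR.
move=> y; rewrite partial_rnorm_ge0/=.
by apply: rnorm_poweR_le => //; exact: measurable_fun_section.
Qed.

End iterated_norms.

(** * Comparison of equal-exponent iterated norms with the product measure *)

Section tonelli.
Context {R : realType} {n : nat} {d : 'I_n -> measure_display}.
Context {T : forall i, measurableType (d i)}.
Variable mu : forall i, {sigma_finite_measure set (T i) -> \bar R}.
Implicit Types (f g : pispace T -> \bar R) (x : pispace T) (ks : seq 'I_n).

(** The same fold as in [pispace_measure]: over [enum 'I_n], an indicator yields the product measure
    of its set by definition. *)
Definition iter_integral ks f : pispace T -> \bar R :=
  foldl (fun g k => partial_integral mu k g) f ks.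

Lemma partial_integral_ge0 k f : (forall x, 0 <= f x) ->
  forall x, 0 <= partial_integral mu k f x.
Proof. by move=> f0 x; exact: integral_ge0. Qed.

Lemma measurable_partial_integral k f : (forall x, 0 <= f x) ->
  measurable_fun setT f -> measurable_fun setT (partial_integral mu k f).
Proof.
move=> f0 mf; exact: (measurable_fun_fubini_tonelli_F
  (fun z : pispace T * T k => f (subst_coord z.1 z.2))
  (measurable_fun_subst_coord (k := k) mf) (fun=> f0 _)).
Qed.

Lemma le_iter_integral ks f g : measurable_fun setT f -> measurable_fun setT g ->
  (forall x, 0 <= f x <= g x) ->
  forall x, iter_integral ks f x <= iter_integral ks g x.
Proof.
elim: ks f g => [f g _ _ fg x|k ks IH f g mf mg fg].
  by case/andP: (fg x).
have f0 x : 0 <= f x by case/andP: (fg x).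
have g0 x : 0 <= g x by case/andP: (fg x) => /le_trans; exact.
apply: IH; [exact: measurable_partial_integral..|].
move=> x; rewrite partial_integral_ge0//=.
apply: ge0_le_integral => //; [exact: measurable_fun_section..|].
by move=> u _; case/andP: (fg (subst_coord x u)).
Qed.

Lemma iter_integral_sum (I : Type) (r : seq I) (a : I -> R)
    (F : I -> pispace T -> \bar R) ks x :
  (forall i, 0 <= a i)%R -> (forall i, measurable_fun setT (F i)) ->
  (forall i x, 0 <= F i x) ->
  iter_integral ks (fun x => \sum_(i <- r) (a i)%:E * F i x) x =
  \sum_(i <- r) (a i)%:E * iter_integral ks (F i) x.
Proof.
move=> a0; elim: ks F => // k ks IH F mF F0 /=.
rewrite -(IH (fun i => partial_integral mu k (F i))); last 2 first.
- by move=> i; exact: measurable_partial_integral.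
- by move=> i; exact: partial_integral_ge0.
congr (iter_integral ks _ x); apply/funext => y; rewrite /partial_integral.
rewrite ge0_integral_sum//; last 2 first.
- by move=> i; apply: measurable_funeM; exact: measurable_fun_section.
- by move=> i u _; rewrite mule_ge0// lee_fin.
apply: eq_bigr => i _; rewrite ge0_integralZl ?lee_fin//.
exact: measurable_fun_section.
Qed.

Import HBNNSimple.

(** For simple functions the two sides agree by linearity. Increasing simple approximations then
    give the bound, by monotone convergence on the left and monotonicity on the right. *)
Lemma integral_pispace_measure_le f : measurable_fun setT f ->
  (forall x, 0 <= f x) ->
  \int[pispace_measure mu]_x f x <= iter_integral (enum 'I_n) f point.
Proof.
move=> mf f0; pose g := nnsfun_approx measurableT mf.
rewrite (_ : \int[_]_x f x = \int[pispace_measure mu]_x limn (EFin \o g ^~ x)).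
  rewrite monotone_convergence//; last 3 first.
  - by move=> k; exact/measurable_EFinP.
  - by move=> k x _; rewrite lee_fin.
  - by move=> x _ i j ij; rewrite lee_fin; exact/lefP/nd_nnsfun_approx.
  apply: lime_le.
    apply: ereal_nondecreasing_is_cvgn => i j ij; apply: ge0_le_integral => //.
    - by move=> x _; rewrite lee_fin.
    - exact/measurable_EFinP.
    - exact/measurable_EFinP.
    - by move=> x _; rewrite lee_fin; exact/lefP/nd_nnsfun_approx.
  apply: nearW => k.
  apply: (@le_trans _ _ (iter_integral (enum 'I_n) (EFin \o g k) point)).
    pose r : seq R := finmap.enum_fset (fset_set (range (g k))).
    (* The absolute value makes the coefficients nonnegative for every real index; on the range of
       [g k] it changes nothing. *)
    have gE x : (g k x)%:E = \sum_(y <- r)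
        `|y|%R%:E * (\1_(g k @^-1` [set y]) x)%:E.
      rewrite fimfunE fsbig_finite//= -sumEFin; apply: eq_big_seq => y.
      by rewrite in_fset_set// inE => -[z _ <-]; rewrite EFinM ger0_norm.
    rewrite (_ : EFin \o g k = fun x => \sum_(y <- r)
      `|y|%R%:E * (EFin \o \1_(g k @^-1` [set y])) x); last exact/funext.
    rewrite iter_integral_sum//; last 2 first.
    - by move=> y; apply/measurable_EFinP; exact: measurable_indic.
    - by move=> y x; rewrite lee_fin.
    rewrite [leLHS](_ : _ = \int[pispace_measure mu]_x
      \sum_(y <- r) `|y|%R%:E * (\1_(g k @^-1` [set y]) x)%:E); last first.
      by apply: eq_integral => x _; exact: gE.
    rewrite ge0_integral_sum//; last first.
      move=> y; apply: measurable_funeM.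
      by apply/measurable_EFinP; exact: measurable_indic.
    apply: lee_sum => y _; rewrite ge0_integralZl ?lee_fin//; last first.
      by apply/measurable_EFinP; exact: measurable_indic.
    by rewrite integral_indic// setIT.
  apply: le_iter_integral => //; first exact/measurable_EFinP.
  move=> x; rewrite lee_fin fun_ge0/=.
  by rewrite nnsfun_approxE; apply: le_approx.
by apply: eq_integral => x _; apply/esym/cvg_lim => //; exact: cvg_nnsfun_approx.
Qed.

Lemma iter_rnorm_cst (q : R) f ks x : (0 < q)%R -> (forall x, 0 <= f x) ->
  iter_rnorm mu [seq (q, k) | k <- ks] f x =
  iter_integral ks (fun x => f x `^ q^-1) x `^ q.
Proof.
move=> q0; elim: ks f => [f f0|k ks IH f f0] /=.
  by rewrite poweRVK// gt_eqF.
rewrite IH; last by move=> y; exact: partial_rnorm_ge0.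
congr (iter_integral ks _ x `^ q); apply/funext => y.
rewrite /partial_rnorm rnormE// poweRK// ?gt_eqF//.
by apply: integral_ge0 => u _; exact: poweR_ge0.
Qed.

(** A function is almost everywhere at most its essential supremum, so the implication from
    [f x <= M] to [g x = 0] passes to the partial norm of [f] and the partial integral of [g]. It
    serves for [g] the indicator of $\{f>M\}$. *)
Lemma iter_integral_eq0 (M : \bar R) f g ks x : 0 <= M ->
  measurable_fun setT f -> measurable_fun setT g ->
  (forall x, 0 <= f x) -> (forall x, 0 <= g x) ->
  (forall x, f x <= M -> g x = 0) ->
  iter_rnorm mu [seq (0%R, k) | k <- ks] f x <= M -> iter_integral ks g x = 0.
Proof.
move=> M0; elim: ks f g => [f g _ _ _ _ fg|k ks IH f g mf mg f0 g0 fg /=].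
  exact: fg.
apply: IH; [exact: measurable_partial_rnorm|exact: measurable_partial_integral|
  by move=> y; exact: partial_rnorm_ge0|exact: partial_integral_ge0|].
move=> y fyM; apply: ae_eq0_integral; last exact: measurable_fun_section.
apply: filterS (rnorm0_ge (mu k) (fun u : T k => f0 (subst_coord y u))) => u fu.
by apply: fg; exact: le_trans fyM.
Qed.

Lemma rnorm_pispace_measure_le (q : R) f : (0 <= q)%R -> measurable_fun setT f ->
  (forall x, 0 <= f x) ->
  rnorm (pispace_measure mu) q f <=
  iter_rnorm mu [seq (q, k) | k <- enum 'I_n] f point.
Proof.
rewrite le_eqVlt => /predU1P[<- mf f0|q0 mf f0]; last first.
  rewrite iter_rnorm_cst// rnormE//; apply: ge0_le_poweR; first exact: ltW.
    by apply: integral_ge0 => x _; exact: poweR_ge0.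
  apply: integral_pispace_measure_le; first exact: measurable_fun_poweR.
  by move=> x; exact: poweR_ge0.
set M := iter_rnorm _ _ _ _.
have M0 : 0 <= M by exact: iter_rnorm_ge0.
apply: rnorm0_le => //; apply/ae_le_measureP => //.
set A := _ @^-1` _.
have mA : measurable A.
  by rewrite -[A]setTI; apply: mf => //; exact: emeasurable_itv.
apply: (@iter_integral_eq0 M f (EFin \o \1_A) (enum 'I_n) point) => //.
- by apply/measurable_EFinP; exact: measurable_indic.
- by move=> x; rewrite lee_fin.
- move=> x fxM; rewrite /= indicE memNset// /A /= in_itv/= andbT.
  by apply/negP; rewrite -leNgt.
Qed.

End tonelli.

(** * The orbit and the average of the exponents of one variable *)

Section orbit_enumeration.
Context {R : realType} {n : nat}.
Implicit Types (p : 'I_n -> \bar R) (s : {perm 'I_n}).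

(** The variable $x_k$ sits at position [(s^-1)%g k], so the two sides are its exponents in the two
    tuples. With the converse below, a class of the orbit amounts to an assignment of exponents to
    variables. *)
Lemma identified_exponent p s s' : identified (DTuple p s) (DTuple p s') ->
  forall k, p ((s^-1)%g k) = p ((s'^-1)%g k).
Proof.
move=> [_ [rho H]] k; have [/= B] := H ((s'^-1)%g k).
rewrite permKV => kE; rewrite [in LHS]kE permK; apply: B.
by rewrite geq_minr leq_maxr.
Qed.

Lemma exponent_identified p s s' :
  (forall i j : 'I_n, (i <= j)%N -> p j <= p i) ->
  (forall k, p ((s^-1)%g k) = p ((s'^-1)%g k)) ->
  identified (DTuple p s) (DTuple p s').
Proof.
(* Permutations compose from left to right: this sends [j] to the position under [s] of the variable
   that [s'] puts at [j]. Both positions carry the same exponent, and monotonicity makes [p]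
   constant between them. *)
move=> p_noninc ss'; split => //=; exists (s' * s^-1)%g => j.
split; last by rewrite permM permKV.
have : p ((s' * s^-1)%g j) = p j by rewrite permM ss' permK.
move: ((s' * s^-1)%g j) => i /= pij l; case/orP: (leq_total i j) => ij.
  rewrite (minn_idPr ij) (maxn_idPl ij) => /andP[il lj].
  by apply/eqP; rewrite eq_le -{1}pij !p_noninc.
rewrite (minn_idPl ij) (maxn_idPr ij) => /andP[jl li].
by apply/eqP; rewrite eq_le -{2}pij !p_noninc.
Qed.

Lemma enumerates_orbit_DTuple p m (P : 'I_m -> dtuple R n) :
  enumerates_orbit p P -> forall i, P i = DTuple p (dvar (P i)).
Proof. by move=> [orbP _] i; have [s ->] := orbP i. Qed.

(* Composing with the transposition of [k] and [l] permutes the classes of the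
   orbit and exchanges the exponents carried by [x_k] and [x_l]. *)
Lemma enumerates_orbit_sum_const p m (P : 'I_m -> dtuple R n) (F : \bar R -> R) :
  (forall i j : 'I_n, (i <= j)%N -> p j <= p i) -> enumerates_orbit p P ->
  forall k l, (\sum_i F (p (((dvar (P i))^-1)%g k)) =
               \sum_i F (p (((dvar (P i))^-1)%g l)))%R.
Proof.
move=> p_noninc enumP k l; have PE := enumerates_orbit_DTuple enumP.
case: (enumP) => _ uniqP.
pose t := tperm k l.
have /choice[phi phiP] i : exists i', identified (DTuple p (dvar (P i) * t)%g) (P i').
  by have [i' []] := uniqP (dvar (P i) * t)%g; exists i'.
have phiE i y : p (((dvar (P i))^-1)%g (t y)) = p (((dvar (P (phi i)))^-1)%g y).
  have := phiP i; rewrite (PE (phi i)) => /identified_exponent <-/=.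
  by rewrite invMg permM tpermV.
(* If two images agree, the tuples agree in the exponent of every variable, as [t] is an involution;
   both indices then represent the class of [P i]. *)
have phi_inj : injective phi.
  move=> i i' ii'.
  have [j [_ uj]] := uniqP (dvar (P i)).
  transitivity j; [apply/esym|]; apply: uj; rewrite [X in identified _ X]PE.
    exact: exponent_identified.
  apply: exponent_identified => // y.
  by rewrite -(tpermK k l y) !phiE ii'.
rewrite (reindex_inj phi_inj); apply: eq_bigr => i _.
by rewrite -phiE tpermL.
Qed.

Lemma enumerates_orbit_gt0 p m (P : 'I_m -> dtuple R n) :
  enumerates_orbit p P -> (0 < m)%N.
Proof. by move=> [_ /(_ 1%g)[i _]]; exact: leq_trans (ltn_ord i). Qed.

(** Double counting over tuples and variables: the sum over tuples is the same for each of the [n]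
    variables, and in each of the [m] tuples the variables carry the exponents $p_1,\ldots,p_n$ in
    some order. *)
Lemma enumerates_orbit_average p m (P : 'I_m -> dtuple R n) (F : \bar R -> R) :
  (forall i j : 'I_n, (i <= j)%N -> p j <= p i) -> enumerates_orbit p P ->
  forall k, (\sum_i m%:R^-1 * F (p (((dvar (P i))^-1)%g k)) =
             n%:R^-1 * \sum_j F (p j))%R.
Proof.
move=> p_noninc enumP k; rewrite -mulr_sumr.
set c := (\sum_i _)%R.
have m0 : (m%:R != 0 :> R)%R.
  by rewrite pnatr_eq0 -lt0n (enumerates_orbit_gt0 enumP).
have n0 : (n%:R != 0 :> R)%R.
  by rewrite pnatr_eq0 -lt0n; exact: leq_trans (ltn_ord k).
suff nc : (n%:R * c = m%:R * \sum_j F (p j))%R.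
  by apply: (mulfI n0); apply: (mulfI m0); rewrite mulVKf// mulrCA mulVKf.
transitivity (\sum_l \sum_i F (p (((dvar (P i))^-1)%g l)))%R.
  rewrite (eq_bigr (fun=> c)); last first.
    by move=> l _; exact: (enumerates_orbit_sum_const F p_noninc enumP).
  by rewrite sumr_const card_ord mulr_natl.
rewrite exchange_big/= (eq_bigr (fun=> \sum_j F (p j))%R); last first.
  by move=> i _; rewrite [RHS](reindex_inj (@perm_inj _ (dvar (P i))^-1%g)).
by rewrite sumr_const card_ord mulr_natl.
Qed.

End orbit_enumeration.

(** * Real reciprocals of the exponents *)

Section exponents.
Context {R : realType} {n : nat} (p : 'I_n -> \bar R).
Hypothesis p_gt0 : forall j, 0 < p j.

Lemma fine_inve_ge0 j : (0 <= fine (p j)^-1)%R.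
Proof. by rewrite fine_ge0// inve_ge0 ltW. Qed.

Lemma inve_fin_num j : (p j)^-1 \is a fin_num.
Proof.
by have := p_gt0 j; case: (p j) => [r| |]//; rewrite lte_fin inver => r0; rewrite gt_eqF.
Qed.

Lemma fine_inveK j : ((fine (p j)^-1)%:E)^-1 = p j.
Proof. by rewrite fineK ?inve_fin_num// inveK. Qed.

Lemma le_fine_inve i j : p j <= p i -> (fine (p i)^-1 <= fine (p j)^-1)%R.
Proof.
move=> pij; rewrite fine_le ?inve_fin_num// lee_pV2 ?inE//; exact: ltW.
Qed.

Lemma exponent_hmeanE :
  exponent_hmean p = ((n%:R^-1 * \sum_j fine (p j)^-1)%R%:E)^-1.
Proof.
rewrite /exponent_hmean EFinM -sumEFin; congr ((_ * _)^-1).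
by apply: eq_bigr => j _; rewrite fineK// inve_fin_num.
Qed.

End exponents.

(** * Mixed norms of the orbit against the common order of variables *)

Section mixed_norm_order.
Context {R : realType} {n : nat} {d : 'I_n -> measure_display}.
Context {T : forall i, measurableType (d i)}.
Variable mu : forall i, {sigma_finite_measure set (T i) -> \bar R}.
Variable p : 'I_n -> \bar R.
Hypothesis p_gt0 : forall j, 0 < p j.
Hypothesis p_noninc : forall i j : 'I_n, (i <= j)%N -> p j <= p i.

Lemma mixed_normE (s : {perm 'I_n}) f :
  mixed_norm mu (DTuple p s) f =
  iter_rnorm mu [seq (fine (p j)^-1, s j) | j <- enum 'I_n] f point.
Proof.
rewrite /mixed_norm /iter_rnorm; elim: (enum 'I_n) f => //= j js IH f.
by rewrite IH /partial_rnorm /rnorm fine_inveK.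
Qed.

Lemma mixed_norm_ge (s : {perm 'I_n}) f : measurable_fun setT f ->
  (forall x, 0 <= f x) ->
  iter_rnorm mu [seq (fine (p ((s^-1)%g k))^-1, k) | k <- enum 'I_n] f point <=
  mixed_norm mu (DTuple p s) f.
Proof.
move=> mf f0; rewrite mixed_normE; apply: iter_rnorm_sorted_ge => //.
(* Both lists hold the same pairs, one indexed by positions and the other by variables. *)
- rewrite (_ : [seq (fine (p j)^-1, s j) | j <- _] =
    [seq (fine (p ((s^-1)%g k))^-1, k) | k <- [seq s j | j <- enum 'I_n]]).
    apply: perm_map; apply: uniq_perm; rewrite ?enum_uniq//.
      by rewrite map_inj_uniq ?enum_uniq//; exact: perm_inj.
    move=> k; rewrite mem_enum; apply/esym/mapP; exists ((s^-1)%g k).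
      by rewrite mem_enum.
    by rewrite permKV.
  by rewrite -map_comp; apply: eq_map => j /=; rewrite permK.
(* Nonincreasing exponents have nondecreasing reciprocals, so the list of the mixed norm is the
   sorted one. *)
- rewrite pairwise_map.
  apply: (@sub_pairwise _ (relpre val leq)).
    by move=> i j /= ij; apply: le_fine_inve => //; exact: p_noninc.
  rewrite -pairwise_map val_enum_ord -sorted_pairwise ?iota_sorted//.
  exact: leq_trans.
- by rewrite -map_comp map_inj_uniq ?enum_uniq//; exact: perm_inj.
- by rewrite all_map; apply/allP => j _ /=; exact: fine_inve_ge0.
Qed.

End mixed_norm_order.

(** * Assembly of the inequality *)

Lemma lee_prode {R : realType} (I : Type) (r : seq I) (F G : I -> \bar R) :
  (forall i, 0 <= F i <= G i) -> \prod_(i <- r) F i <= \prod_(i <- r) G i.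
Proof.
move=> FG; elim: r => [|i r IH]; rewrite ?big_nil// !big_cons.
have /andP[F0 FGi] := FG i; apply: lee_pmul => //.
by apply: prode_ge0 => j _; case/andP: (FG j).
Qed.

Theorem corollary3p6 (R : realType) (n : nat) (n_gt0 : (0 < n)%N)
    (d : 'I_n -> measure_display) (T : forall i : 'I_n, measurableType (d i))
    (mu : forall i : 'I_n, {sigma_finite_measure set (T i) -> \bar R})
    (p : 'I_n -> \bar R) (p_gt0 : forall j, 0 < p j)
    (p_noninc : forall i j : 'I_n, (i <= j)%N -> p j <= p i)
    (m : nat) (P : 'I_m -> dtuple R n) (enumP : enumerates_orbit p P)
    (f : 'I_m -> pispace T -> \bar R) (f_ge0 : forall i x, 0 <= f i x)
    (f_meas : forall i, measurable_fun [set: pispace T] (f i)) :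
  'N[pispace_measure mu]_(exponent_hmean p)
      [(fun x => \prod_(i < m) (f i x) `^ (m%:R^-1)%R)]
    <= \prod_(i < m) (mixed_norm mu (P i) (f i)) `^ (m%:R^-1)%R.
Proof.
pose a : R := (m%:R^-1)%R.
have a0 : (0 < a)%R by rewrite invr_gt0 ltr0n (enumerates_orbit_gt0 enumP).
pose t i k : R := fine (p (((dvar (P i))^-1)%g k))^-1.
have t0 i k : (0 <= t i k)%R by exact: fine_inve_ge0.
have mfa i : measurable_fun setT (fun x => f i x `^ a).
  exact: measurable_fun_poweR.
have fa0 i x : 0 <= f i x `^ a by exact: poweR_ge0.
rewrite (exponent_hmeanE p_gt0) -/(rnorm _ _ _).
apply: le_trans (rnorm_pispace_measure_le mu _ _ _) _.
- by rewrite mulr_ge0 ?invr_ge0 ?ler0n// sumr_ge0// => j _; exact: fine_inve_ge0.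
- exact: measurable_fun_prode.
- by move=> x; apply: prode_ge0 => i _.
(* The power [a] on each factor multiplies its reciprocal exponents by [a], which turns their sum
   over the orbit into an average. *)
rewrite (_ : map _ _ = [seq (\sum_(i < m) a * t i k, k)%R | k <- enum 'I_n]); last first.
  apply: eq_map => k; congr pair; apply/esym.
  exact: (enumerates_orbit_average (fun x => fine x^-1) p_noninc enumP).
have at0 i k : (0 <= a * t i k)%R by rewrite mulr_ge0// ltW.
apply: le_trans (iter_rnorm_prod_le mu (index_enum _) (enum 'I_n) point at0 mfa fa0) _.
apply: lee_prode => i; rewrite iter_rnorm_ge0//=.
apply: le_trans (iter_rnorm_poweR_le _ _ _ _ _ _ _) _ => //.
apply: ge0_le_poweR; [exact: ltW|exact: iter_rnorm_ge0|].
by rewrite (enumerates_orbit_DTuple enumP i); exact: mixed_norm_ge.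
Qed.
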